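(* Let $R$ be a ring, let $\delta$ be an expansion function of ideals of $R$, and let $I$ be a weakly $\delta$-semiprimary ideal of $R$ that is not $\delta$-semiprimary. Then $I^2 = \{0\}$, and hence $I \subseteq \sqrt{\{0\}}$.
   Context: All rings are commutative with $1 \neq 0$. $I(R)$ denotes the set of all ideals of $R$ (including $R$ itself); an ideal $I$ is proper if $I \neq R$. $\sqrt{\{0\}}$ is the ideal of nilpotent elements of $R$. A function $\delta : I(R) \to I(R)$ is an expansion function of ideals of $R$ if $L \subseteq \delta(L)$ for every ideal $L$ of $R$, and $\delta(J) \subseteq \delta(I)$ whenever $J \subseteq I$ are ideals of $R$. A proper ideal $I$ of $R$ is $\delta$-semiprimary if whenever $a,b \in R$ and $ab \in I$, then $a \in \delta(I)$ or $b \in \delta(I)$. A proper ideal $I$ of $R$ is weakly $\delta$-semiprimary if whenever $a,b\in R$ and $0 \neq ab \in I$, then $a \in \delta(I)$ or $b \in \delta(I)$. *)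

(* Defs.v *)
From mathcomp Require Import all_boot all_order all_algebra.
From mathcomp Require Import boolp classical_sets.

Set Implicit Arguments.
Unset Strict Implicit.
Unset Printing Implicit Defensive.

Import GRing.Theory.
Local Open Scope ring_scope.
Local Open Scope classical_set_scope.

(* The library's [idealr] (ring_quotient) only covers proper ideals with a
   boolean membership test; here [R] itself counts as an ideal and membership
   is an arbitrary proposition. *)
Record ideal (R : comNzRingType) := Ideal {
  ideal_set :> set R;
  ideal0 : ideal_set 0;
  idealD : forall x y, ideal_set x -> ideal_set y -> ideal_set (x + y);
  idealMl : forall a x, ideal_set x -> ideal_set (a * x) }.

(* Lets [I x] stand for membership, as for [set R]. *)
Definition ideal_mem (R : comNzRingType) (I : ideal R) (x : R) : Prop :=
  ideal_set I x.
Coercion ideal_mem : ideal >-> Funclass.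

Definition ideal_proper (R : comNzRingType) (I : ideal R) : Prop :=
  (I : set R) <> setT.

Section Product.
Variables (R : comNzRingType) (I J : ideal R).

Definition idealM_set : set R :=
  [set x | exists n (f g : 'I_n -> R),
    [/\ forall i, I (f i), forall i, J (g i) & x = \sum_(i < n) f i * g i]].

Lemma idealM0 : idealM_set 0.
Proof.
exists 0%N, (fun=> 0), (fun=> 0); split=> [i|i|]; [exact: ideal0 | exact: ideal0 |].
by rewrite big_ord0.
Qed.

Lemma idealMD x y : idealM_set x -> idealM_set y -> idealM_set (x + y).
Proof.
move=> [m [f [g [If Jg ->]]]] [n [f' [g' [If' Jg' ->]]]].
pose cat (u : 'I_m -> R) (v : 'I_n -> R) (k : 'I_(m + n)) :=
  match split k with inl i => u i | inr j => v j end.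
exists (m + n)%N, (cat f f'), (cat g g'); split=> [k|k|].
- by rewrite /cat; case: (split k).
- by rewrite /cat; case: (split k).
rewrite big_split_ord /=; congr (_ + _); apply: eq_bigr => i _.
  by rewrite /cat (unsplitK (inl i)).
by rewrite /cat (unsplitK (inr i)).
Qed.

Lemma idealMMl a x : idealM_set x -> idealM_set (a * x).
Proof.
move=> [n [f [g [If Jg ->]]]]; exists n, (fun i => a * f i), g; split=> //.
  by move=> i; apply: idealMl; exact: If.
by rewrite mulr_sumr; apply: eq_bigr => i _; rewrite mulrA.
Qed.

Definition idealM : ideal R := Ideal idealM0 idealMD idealMMl.

End Product.

Section Nilradical.
Variable R : comNzRingType.

Definition nilradical_set : set R := [set x | exists n, x ^+ n = 0].

Lemma nilradical0 : nilradical_set 0.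
Proof. by exists 1%N; rewrite expr1. Qed.

Lemma nilradicalD x y :
  nilradical_set x -> nilradical_set y -> nilradical_set (x + y).
Proof.
move=> [m xm0] [n yn0]; exists (m + n)%N; rewrite exprDn big1 // => -[i /= lei] _.
have [len|ltn] := leqP n i.
  by rewrite -(subnK len) exprD yn0 !mulr0 mul0rn.
have lem : (m <= m + n - i)%N by rewrite -addnBA ?leq_addr // ltnW.
by rewrite -(subnK lem) exprD xm0 mulr0 mul0r mul0rn.
Qed.

Lemma nilradicalMl a x : nilradical_set x -> nilradical_set (a * x).
Proof. by move=> [n xn0]; exists n; rewrite exprMn xn0 mulr0. Qed.

Definition nilradical : ideal R := Ideal nilradical0 nilradicalD nilradicalMl.

End Nilradical.

Definition expansion_function (R : comNzRingType) (delta : ideal R -> ideal R)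
    : Prop :=
  (forall L : ideal R, L `<=` delta L) /\
  (forall I J : ideal R, J `<=` I -> delta J `<=` delta I).

Definition semiprimary (R : comNzRingType) (delta : ideal R -> ideal R)
    (I : ideal R) : Prop :=
  ideal_proper I /\
  forall a b : R, I (a * b) -> delta I a \/ delta I b.

Definition weakly_semiprimary (R : comNzRingType)
    (delta : ideal R -> ideal R) (I : ideal R) : Prop :=
  ideal_proper I /\
  forall a b : R, a * b != 0 -> I (a * b) -> delta I a \/ delta I b.

(* Main.v *)
Require Import Defs.
From mathcomp Require Import all_boot all_order all_algebra.
From mathcomp Require Import boolp classical_sets.
Local Open Scope ring_scope.
Local Open Scope classical_set_scope.

(** An ideal [I] that is weakly [delta]-semiprimary but not
    [delta]-semiprimary has a witness [a * b = 0] with [a] and [b] both outside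
    [delta I] ([semiprimary_failure]).  Since [I] lies in [delta I], translating
    [a] and [b] by elements of [I] does not bring them into [delta I], so the
    translates can be fed to the weak condition again: whenever a product of
    translates lies in [I], it must vanish ([translate_mul_eq0]).  Translating
    only one factor gives [a * y = 0] and [x * b = 0] for [x], [y] in [I];
    translating both then leaves [(a + x) * (b + y) = x * y], which is therefore
    zero ([mul_eq0_of_failure]).  Thus [I ^ 2] vanishes, and in particular every
    element of [I] squares to zero. *)

Import GRing.Theory.

Lemma idealDr_mem (R : comNzRingType) (J : ideal R) (a x : R) :
  J x -> J (a + x) -> J a.
Proof.
move=> Jx Jax; have -> : a = (a + x) + (-1) * x by rewrite mulN1r addrK.
by apply: idealD => //; apply: idealMl.
Qed.

(** The two conditions differ only on pairs with product zero, so a failure of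
    the stronger one is witnessed by such a pair. *)
Lemma semiprimary_failure (R : comNzRingType) (delta : ideal R -> ideal R)
    (I : ideal R) :
  weakly_semiprimary delta I -> ~ semiprimary delta I ->
  exists a b : R, [/\ a * b = 0, ~ delta I a & ~ delta I b].
Proof.
move=> [properI wI] nsI; apply: contrapT => noab; apply: nsI.
split=> // a b Iab; have [ab0|abn0] := eqVneq (a * b) 0; last exact: wI.
have [da|nda] := pselect (delta I a); first by left.
have [db|ndb] := pselect (delta I b); first by right.
by case: noab; exists a, b.
Qed.

Section Failure.

Context {R : comNzRingType} {delta : ideal R -> ideal R} {I : ideal R}.
Hypothesis Idelta : I `<=` delta I.
Hypothesis wI : weakly_semiprimary delta I.
Context {a b : R}.
Hypothesis (ab0 : a * b = 0) (nda : ~ delta I a) (ndb : ~ delta I b).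

(** Membership in [delta I] is invariant under translation by [I], so a nonzero
    product in [I] would contradict the weak condition. *)
Lemma translate_mul_eq0 (x y : R) :
  I x -> I y -> I ((a + x) * (b + y)) -> (a + x) * (b + y) = 0.
Proof.
move=> Ix Iy Ip; have [//|pn0] := eqVneq ((a + x) * (b + y)) 0.
have [dax|dby] := wI.2 _ _ pn0 Ip.
- by case: nda; apply: idealDr_mem dax; apply: Idelta.
- by case: ndb; apply: idealDr_mem dby; apply: Idelta.
Qed.

Lemma mul_eq0_of_failure (x y : R) : I x -> I y -> x * y = 0.
Proof.
move=> Ix Iy.
have I0 : I 0 := ideal0 I.
have ay0 : a * y = 0.
  have E : (a + 0) * (b + y) = a * y by rewrite addr0 mulrDr ab0 add0r.
  by rewrite -E; apply: translate_mul_eq0 => //; rewrite E; apply: idealMl.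
have xb0 : x * b = 0.
  have E : (a + x) * (b + 0) = x * b by rewrite addr0 mulrDl ab0 add0r.
  rewrite -E; apply: translate_mul_eq0 => //.
  by rewrite E mulrC; apply: idealMl.
have E : (a + x) * (b + y) = x * y.
  by rewrite mulrDl !mulrDr ab0 ay0 xb0 !add0r.
by rewrite -E; apply: translate_mul_eq0 => //; rewrite E; apply: idealMl.
Qed.

End Failure.

Theorem theorem2p7 (R : comNzRingType) (delta : ideal R -> ideal R)
    (I : ideal R) :
  expansion_function delta ->
  weakly_semiprimary delta I ->
  ~ semiprimary delta I ->
  idealM I I = [set 0] :> set R /\ I `<=` nilradical R.
Proof.
move=> [Idelta _] wI nsI.
have [a [b [ab0 nda ndb]]] := semiprimary_failure _ _ _ wI nsI.
have II0 := mul_eq0_of_failure (Idelta I) wI ab0 nda ndb.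
split; last by move=> x Ix; exists 2%N; rewrite expr2; apply: II0.
apply/seteqP; split=> [z [n [f [g [If Ig ->]]]]|_ ->]; last exact: ideal0.
by rewrite /= big1 // => i _; apply: II0.
Qed.
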